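(* Let $A$ be a $(d+1)\times(d+1)$ complex matrix satisfying the $K$-condition with diagonal matrices $\mathrm p$ and $D$, i.e. $A^*\mathrm pA=D$, and let $N\ge 0$. Then the Krawtchouk matrix $\Phi=(\bar A)^*$ in degree $N$ satisfies the orthogonality relation $$\Phi\,B\,\bar{\mathrm p}\,\Phi^*=B\,\bar D.$$
   Context: Matrices have rows and columns indexed by $0,1,\dots,d$; $A^*$ is the Hermitian transpose. A matrix $A$ satisfies the $K$-condition if $A_{i0}=1$ for $0\le i\le d$ and there exist a diagonal matrix $\mathrm p=\mathrm{diag}(p_0,\dots,p_d)$ with all $p_i>0$ and $\sum_i p_i=1$, and a diagonal matrix $D$ with positive diagonal entries, such that $A^*\mathrm pA=D$. Multi-indices are tuples $n=(n_0,\dots,n_d)$ of nonnegative integers, $|n|=\sum_i n_i$, $x^n=x_0^{n_0}\cdots x_d^{n_d}$. For an integer $N\ge 0$, the symmetric power $\bar A$ of a matrix $A$ in degree $N$ is the matrix indexed by multi-indices $m,n$ with $|m|=|n|=N$ defined by $(Ax)^m=\sum_{|n|=N}\bar A_{mn}x^n$, where $(Ax)_i=\sum_j A_{ij}x_j$. The bar always denotes this symmetric power map in degree $N$ (never complex conjugation). $B$ is the diagonal matrix indexed by multi-indices of total degree $N$ with $B_{mm}=\frac{N!}{m_0!\cdots m_d!}$. *)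

(* Defs.v *)
From HB Require Import structures.
From mathcomp Require Import all_boot all_order all_algebra.
From mathcomp Require Import complex mpoly reals.

Set Implicit Arguments.
Unset Strict Implicit.
Unset Printing Implicit Defensive.

Import GRing.Theory Num.Theory.
Local Open Scope ring_scope.

Section Defs.

Variables (C : numClosedFieldType) (d : nat).

Definition adjmx m n (A : 'M[C]_(m, n)) : 'M[C]_(n, m) :=
  (map_mx Num.conj A)^T.

(* In a numClosedFieldType, [0 < z] says that z is real and positive. *)
Definition K_condition_with (A p D : 'M[C]_d.+1) : Prop :=
  [/\ forall i, A i ord0 = 1,
      [/\ is_diag_mx p, forall i, 0 < p i i & \sum_i p i i = 1],
      is_diag_mx D /\ (forall i, 0 < D i i)
    & adjmx A *m p *m A = D].

Variable N : nat.

(* The bound [mdeg m < N.+1] only serves to make the type finite. *)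
Definition multiindex : Type :=
  {m : 'X_{1..d.+1 < N.+1} | mdeg m == N}.

HB.instance Definition _ := Finite.on multiindex.

(* Matrices indexed by multi-indices are ordinary matrices, whose row and
   column numbers enumerate [multiindex]. *)
Definition mi (i : 'I_#|{: multiindex}|) : 'X_{1..d.+1} :=
  val (val (enum_val i)).

Definition linform (A : 'M[C]_d.+1) (i : 'I_d.+1) : {mpoly C[d.+1]} :=
  \sum_j A i j *: 'X_j.

Definition linform_pow (A : 'M[C]_d.+1) (m : 'X_{1..d.+1}) :
  {mpoly C[d.+1]} := \prod_i linform A i ^+ m i.

Definition sympow (A : 'M[C]_d.+1) : 'M[C]_#|{: multiindex}| :=
  \matrix_(i, j) (linform_pow A (mi i))@_(mi j).

Definition multinomial_mx : 'M[C]_#|{: multiindex}| :=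
  diag_mx (\row_i (N`!%:R / \prod_(k < d.+1) ((mi i k)`!)%:R)).

Definition krawtchouk (A : 'M[C]_d.+1) : 'M[C]_#|{: multiindex}| :=
  adjmx (sympow A).

Lemma linform_pow_homog (A : 'M[C]_d.+1) (m : 'X_{1..d.+1}) :
  linform_pow A m \is (mdeg m).-homog.
Proof.
rewrite mdegE /linform_pow.
elim/big_ind2: _ => [|p1 e1 p2 e2 h1 h2|i _]; first exact: dhomog1.
  exact: dhomogM.
rewrite -[X in X.-homog]mul1n; apply: dhomogMn.
by apply: rpred_sum => j _; apply: dhomogZ; rewrite dhomogX /= mdeg1.
Qed.

Lemma mi_deg i : mdeg (mi i) = N.
Proof. by apply/eqP; exact: (valP (enum_val i)). Qed.

Lemma mi_inj : injective mi.
Proof. by move=> i j /val_inj/val_inj/enum_val_inj. Qed.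

Lemma mi_surj (m : 'X_{1..d.+1}) : mdeg m = N -> exists i, mi i = m.
Proof.
move=> hm; have hb : (mdeg m < N.+1)%N by rewrite hm.
have hm' : mdeg (BMultinom hb) == N by apply/eqP.
by exists (enum_rank (exist _ (BMultinom hb) hm' : multiindex));
   rewrite /mi enum_rankK.
Qed.

(* (A x)^m = sum over |n| = N of the entries (m, n) times x^n. *)
Lemma sympowE (A : 'M[C]_d.+1) i :
  linform_pow A (mi i) = \sum_j sympow A i j *: 'X_[mi j].
Proof.
apply/mpolyP => n; rewrite raddf_sum /=.
have [/eqP/mi_surj[k <-]|hn] := boolP (mdeg n == N).
  rewrite (bigD1 k) //= mcoeffZ mcoeffX eqxx mulr1 mxE big1 ?addr0 // => j jk.
  by rewrite mcoeffZ mcoeffX (inj_eq mi_inj) (negPf jk) mulr0.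
rewrite big1 => [|j _].
  by apply: dhomog_nemf_coeff (linform_pow_homog A (mi i)) _; rewrite mi_deg.
rewrite mcoeffZ mcoeffX; case: eqP => [e|_]; last by rewrite mulr0.
by rewrite -e mi_deg eqxx in hn.
Qed.

End Defs.

(* Main.v *)
Require Import Defs.
From mathcomp Require Import all_boot all_order all_algebra.
From mathcomp Require Import complex mpoly reals.

(** The degree-N symmetric power is a representation: substituting y := Y x in
    (X y)^m shows that it sends products to products ([sympowM]).  It does not
    commute with transposition, but only fails to do so by the multinomial
    weights: B (tr A)bar = tr(Abar) B ([sympow_tr]).  Indeed, expanding the
    N-th power of the bilinear form sum_(k,l) A_kl u_k v_l with the multinomial
    theorem, grouping first by the u_k and then by the v_l, computes the
    coefficient of u^m v^n in two ways, as B_mm Abar_mn and as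
    B_nn (tr A)bar_nm.

    Combined with compatibility with conjugation ([sympow_map]), this gives
    Phi B = B (adj A)bar ([krawtchouk_multinomial]), so that
    Phi B pbar adj(Phi) = B (adj A)bar pbar Abar = B (adj(A) p A)bar = B Dbar. *)

Set Implicit Arguments.
Unset Strict Implicit.
Unset Printing Implicit Defensive.
Import GRing.Theory Num.Theory.
Local Open Scope ring_scope.

(** Multiplying by the factorials of [m] makes the formula uniform: when
    [m i = 0], subtraction truncates and [m - U_(i)] is just [m], but the factor
    [m i] then makes the right-hand side vanish, as the left-hand side does. *)
Lemma fact_mcoeffMX (S : comNzRingType) n (P : {mpoly S[n]}) i (m : 'X_{1..n}) :
  (P * 'X_i)@_m *+ \prod_k (m k)`! =
    P@_(m - U_(i)) *+ (\prod_k ((m - U_(i))%MM k)`! * m i).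
Proof.
have [mi0|mi_gt0] := posnP (m i).
  rewrite mi0 muln0 mulr0n; suff -> : (P * 'X_i)@_m = 0 by rewrite mul0rn.
  rewrite [P]mpolyE mulr_suml raddf_sum big1 //= => k _.
  rewrite -scalerAl -mpolyXD mcoeffZ mcoeffX; case: eqP => [km|_]; last first.
    by rewrite mulr0.
  by move: mi0; rewrite -km mnmDE mnm1E eqxx addn1.
have Um : (U_(i) <= m)%MM by rewrite lep1mP -lt0n.
rewrite -{1}(submK Um) addmC mcoeffMX; congr (_ *+ _).
rewrite (bigD1 i) //= [in RHS](bigD1 i) //= mnmBE mnm1E eqxx subn1.
rewrite mulnAC; congr (_ * _)%N.
  by rewrite -[in LHS](prednK mi_gt0) factS prednK // mulnC.
by apply: eq_bigr => j ji; rewrite mnmBE mnm1E eq_sym (negPf ji) subn0.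
Qed.

(** The multinomial theorem in its division-free, coefficient form.  In the
    induction step the [i]-th summand contributes [N! * m i], and the [m i] add
    up to [N.+1]. *)
Lemma fact_mcoeff_sumX (S : comNzRingType) n N (m : 'X_{1..n}) : mdeg m = N ->
  ((\sum_i 'X_i : {mpoly S[n]}) ^+ N)@_m *+ \prod_k (m k)`! = N`!%:R.
Proof.
elim: N m => [|N IHN] m degm.
  move/eqP: degm; rewrite mdeg_eq0 => /eqP ->.
  by rewrite expr0 mcoeff1 eqxx big1 // => k _; rewrite mnm0E.
rewrite exprSr mulr_sumr raddf_sum -sumrMnl /=.
rewrite (eq_bigr (fun i => N`!%:R *+ m i)) => [|i _].
  by rewrite sumrMnr -mdegE degm -mulrnA mulnC -factS.
rewrite fact_mcoeffMX mulrnA; have [->//|mi_gt0] := posnP (m i).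
congr (_ *+ _); apply: IHN.
have Um : (U_(i) <= m)%MM by rewrite lep1mP -lt0n.
by move: degm; rewrite -{1}(submK Um) mdegD mdeg1 addn1 => -[].
Qed.

Section SymPow.
Variables (C : numClosedFieldType) (d N : nat).
Implicit Types (A X Y : 'M[C]_d.+1) (i j : 'I_#|{: multiindex d N}|).

Definition multinom_coef i : C := N`!%:R / \prod_(k < d.+1) ((mi i k)`!)%:R.

(** The values [x k] may lie in any commutative ring receiving [C]: the identity
    is proved for the indeterminates and then specialised.  The generality is
    used for polynomials whose coefficients are again polynomials. *)
Lemma multinomial_theorem (S : comNzRingType) (f : {rmorphism C -> S})
    (x : 'I_d.+1 -> S) :
  (\sum_k x k) ^+ N = \sum_j f (multinom_coef j) * \prod_k x k ^+ mi j k.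
Proof.
have homN : (\sum_k 'X_k : {mpoly C[d.+1]}) ^+ N \is N.-homog.
  rewrite -[X in X.-homog]mul1n; apply: dhomogMn.
  by apply: rpred_sum => k _; rewrite dhomogX /= mdeg1.
have expand : (\sum_k 'X_k : {mpoly C[d.+1]}) ^+ N
    = \sum_j multinom_coef j *: 'X_[mi j].
  apply/mpolyP => m; rewrite raddf_sum /=.
  have [/eqP/mi_surj[k <-]|degm] := boolP (mdeg m == N).
    rewrite (bigD1 k) //= mcoeffZ mcoeffX eqxx mulr1 [X in _ + X]big1 ?addr0 => [|j jk].
      rewrite -[multinom_coef k]/(_ / _) -natr_prod.
      rewrite -(fact_mcoeff_sumX C (mi_deg k)) -[X in X / _]mulr_natr mulfK //.
      rewrite pnatr_eq0 -lt0n prodn_gt0 // => l; exact: fact_gt0.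
    by rewrite mcoeffZ mcoeffX (inj_eq (@mi_inj _ _)) (negPf jk) mulr0.
  rewrite (dhomog_nemf_coeff homN degm) [RHS]big1 // => j _.
  rewrite mcoeffZ mcoeffX; case: eqP => [jm|_]; last by rewrite mulr0.
  by rewrite -jm mi_deg eqxx in degm.
have := congr1 (mmap f x) expand; rewrite rmorphXn raddf_sum.
rewrite (eq_bigr x) => [->|k _]; last by rewrite /= mmapX mmap1U.
by rewrite raddf_sum; apply: eq_bigr => j _; rewrite /= mmapZ mmapX.
Qed.

Lemma linform_comp X Y k :
  linform (X *m Y) k = linform X k \mPo [tuple linform Y l | l < d.+1].
Proof.
rewrite [linform X k]/linform raddf_sum.
rewrite [RHS](eq_bigr (fun l => X k l *: linform Y l)).
  rewrite /linform; under [in RHS]eq_bigr => l _ do rewrite scaler_sumr.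
  rewrite exchange_big; apply: eq_bigr => j _.
  by rewrite mxE scaler_suml; apply: eq_bigr => l _; rewrite scalerA.
by move=> l _; rewrite /= comp_mpolyZ comp_mpolyXU -tnth_nth tnth_mktuple.
Qed.

Lemma sympowM X Y : sympow N (X *m Y) = sympow N X *m sympow N Y.
Proof.
apply/matrixP => i j; rewrite mxE.
have -> : linform_pow (X *m Y) (mi i)
    = linform_pow X (mi i) \mPo [tuple linform Y l | l < d.+1].
  rewrite /linform_pow rmorph_prod; apply: eq_bigr => k _.
  by rewrite rmorphXn linform_comp.
rewrite sympowE (raddf_sum (comp_mpoly _)) raddf_sum [RHS]mxE; apply: eq_bigr => k _.
rewrite /= comp_mpolyZ mcoeffZ comp_mpolyX [sympow N Y k j]mxE.
by congr (_ * _@__); apply: eq_bigr => l _; rewrite tnth_mktuple.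
Qed.

Lemma sympow_map (f : {rmorphism C -> C}) A :
  sympow N (map_mx f A) = map_mx f (sympow N A).
Proof.
apply/matrixP => i j; rewrite !mxE -mcoeff_map_mpoly; congr _@__.
rewrite rmorph_prod; apply: eq_bigr => k _; rewrite rmorphXn; congr (_ ^+ _).
rewrite raddf_sum; apply: eq_bigr => l _.
by rewrite /= map_mpolyZ map_mpolyX mxE.
Qed.

(** Both sides expand the [N]-th power of the bilinear form
    [\sum_(k, l) A k l u_k v_l], seen as a linear form in the [u_k] on the left
    and in the [v_l] on the right.  Here [u] and [v] are two copies of the
    polynomial ring inside a common ring [T]. *)
Lemma bilinear_pow_expansions (T : comNzRingType) (f : {rmorphism C -> T})
    (u v : {rmorphism {mpoly C[d.+1]} -> T}) A :
  (forall c q, u (c *: q) = f c * u q) ->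
  (forall c q, v (c *: q) = f c * v q) ->
  \sum_k f (multinom_coef k) * (u 'X_[mi k] * v (linform_pow A (mi k))) =
  \sum_k f (multinom_coef k) * (u (linform_pow A^T (mi k)) * v 'X_[mi k]).
Proof.
move=> uZ vZ.
have prodE (q w : 'I_d.+1 -> {mpoly C[d.+1]}) (m : 'X_{1..d.+1}) :
    u (\prod_k q k ^+ m k) * v (\prod_k w k ^+ m k)
    = \prod_k (u (q k) * v (w k)) ^+ m k.
  rewrite !rmorph_prod -big_split; apply: eq_bigr => k _.
  by rewrite exprMn !rmorphXn.
have bilin : \sum_k u 'X_k * v (linform A k)
    = \sum_l u (linform A^T l) * v 'X_l.
  rewrite /linform.
  under eq_bigr => k _ do rewrite (rmorph_sum v) mulr_sumr.
  rewrite exchange_big; apply: eq_bigr => l _.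
  rewrite (rmorph_sum u) mulr_suml; apply: eq_bigr => k _.
  by rewrite uZ vZ mxE mulrCA mulrA.
under eq_bigr => k _ do rewrite mpolyXE_id prodE.
under [RHS]eq_bigr => k _ do rewrite mpolyXE_id prodE.
by rewrite -!multinomial_theorem bilin.
Qed.

(** [g] plays the role of the coefficient of [u^(mi i) v^(mi j)].  On each
    side of the previous identity it leaves a single term. *)
Lemma sympow_tr_from_coef (T : comNzRingType) (f : {rmorphism C -> T})
    (u v : {rmorphism {mpoly C[d.+1]} -> T}) (g : {additive T -> C}) A i j :
  (forall c q, u (c *: q) = f c * u q) ->
  (forall c q, v (c *: q) = f c * v q) ->
  (forall c q r, g (f c * (u q * v r)) = c * (q@_(mi i) * r@_(mi j))) ->
  multinom_coef i * sympow N A i j = multinom_coef j * sympow N A^T j i.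
Proof.
move=> uZ vZ coefE.
have := congr1 g (bilinear_pow_expansions A uZ vZ).
rewrite !(raddf_sum g); under eq_bigr => k _ do rewrite coefE.
under [X in _ = X -> _]eq_bigr => k _ do rewrite coefE.
rewrite (bigD1 i) //= [X in _ + X = _ -> _]big1 => [|k ki]; last first.
  by rewrite mcoeffX (inj_eq (@mi_inj _ _)) (negPf ki) mul0r mulr0.
rewrite (bigD1 j) //= [X in _ = _ + X -> _]big1 => [|k kj]; last first.
  by rewrite mcoeffX (inj_eq (@mi_inj _ _)) (negPf kj) !mulr0.
by rewrite !mcoeffX !eqxx mulr1 mul1r !addr0 !mxE.
Qed.

(** This is the relation [B (tr A)bar = tr(Abar) B], entrywise.  The two sets of
    variables are realised as polynomials in [v] over the polynomials in [u]. *)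
Lemma sympow_tr A i j :
  multinom_coef i * sympow N A i j = multinom_coef j * sympow N A^T j i.
Proof.
pose S := {mpoly C[d.+1]}.
pose f : {rmorphism C -> {mpoly S[d.+1]}} :=
  (@mpolyC d.+1 S \o @mpolyC d.+1 C).
pose u : {rmorphism S -> {mpoly S[d.+1]}} := @mpolyC d.+1 S.
pose v : {rmorphism S -> {mpoly S[d.+1]}} := map_mpoly (@mpolyC d.+1 C).
pose g : {additive {mpoly S[d.+1]} -> C} := mcoeff (mi i) \o mcoeff (mi j).
apply: (@sympow_tr_from_coef _ f u v g) => [c q|c q|c q r].
- by rewrite -mul_mpolyC rmorphM.
- by rewrite /v /= map_mpolyZ mul_mpolyC.
rewrite /g /= /f /u /v /= !mul_mpolyC !mcoeffZ mcoeff_map_mpoly.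
by rewrite mul_mpolyC mcoeffZ [q * _]mulrC mul_mpolyC mcoeffZ [r@__ * _]mulrC.
Qed.

Lemma multinomial_mxM (M : 'M[C]_#|{: multiindex d N}|) i j :
  (multinomial_mx C d N *m M) i j = multinom_coef i * M i j.
Proof. by rewrite mul_diag_mx !mxE. Qed.

(** Conjugation passes through the symmetric power exactly, transposition up to
    the multinomial weights. *)
Lemma krawtchouk_multinomial A :
  krawtchouk N A *m multinomial_mx C d N
  = multinomial_mx C d N *m sympow N (adjmx A).
Proof.
apply/matrixP => i j; rewrite multinomial_mxM mul_mx_diag !mxE.
rewrite -/(multinom_coef j) mulrC.
have -> : Num.conj (linform_pow A (mi j))@_(mi i)
    = sympow N (map_mx Num.conj A) j i.
  by rewrite sympow_map !mxE.
by rewrite sympow_tr mxE.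
Qed.
End SymPow.

Lemma adjmxK (C : numClosedFieldType) m n (A : 'M[C]_(m, n)) :
  adjmx (adjmx A) = A.
Proof. by apply/matrixP => i j; rewrite !mxE conjCK. Qed.

Theorem proposition5p6 (R : realType) (d N : nat) (A p D : 'M[R[i]]_d.+1)
    (hA : K_condition_with A p D) :
  let Phi := krawtchouk N A in
  let B := multinomial_mx R[i] d N in
  Phi *m B *m sympow N p *m adjmx Phi = B *m sympow N D.
Proof.
have [_ _ _ <-] := hA => /=.
by rewrite adjmxK krawtchouk_multinomial !sympowM !mulmxA.
Qed.
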